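(* Let $X$ be an irreducible nondegenerate variety in $\mathbb{P}^N$ over an algebraically closed field of characteristic zero, and let $g$ be the generic rank with respect to $X$. For every $k \geq 1$, $\operatorname{codim} W_{g+k} \geq 2k-1$.
   Context: The rank of a point $p\in\mathbb{P}^N$ with respect to $X$ is the least $r$ such that $p$ lies in the linear span of some $r$ distinct points of $X$; $W_j$ is the Zariski closure of the set of points of rank exactly $j$; the generic rank $g$ is the rank attained on a dense open subset of $\mathbb{P}^N$. *)

(* Defs.v *)
From HB Require Import structures.
From mathcomp Require Import all_boot all_order all_algebra.
From mathcomp Require Import mpoly.
Set Implicit Arguments. Unset Strict Implicit. Unset Printing Implicit Defensive.
Import Order.TTheory GRing.Theory Num.Theory.
Local Open Scope ring_scope.

(* Projective space P^N over F: a point is represented by a nonzero vector of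
   F^(N+1) (homogeneous coordinates); a subset of P^N is represented by a
   predicate on vectors.  Zariski closed sets are common zero loci of families
   of homogeneous polynomials, so they are automatically stable by scaling. *)

Definition pt (F : fieldType) (N : nat) := 'rV[F]_(N.+1).
Definition pset (F : fieldType) (N : nat) := pt F N -> Prop.

Definition ev (F : fieldType) (N : nat) (p : {mpoly F[N.+1]}) (v : pt F N) : F :=
  p.@[fun i => v ord0 i].

Definition homogeneous (F : fieldType) (N : nat) (p : {mpoly F[N.+1]}) : Prop :=
  exists d, p \is d.-homog.

Definition zclosed (F : fieldType) (N : nat) (Z : pset F N) : Prop :=
  exists S : {mpoly F[N.+1]} -> Prop,
    (forall p, S p -> homogeneous p) /\
    forall v, Z v <-> (v != 0 /\ forall p, S p -> ev p v = 0).

Definition zopen (F : fieldType) (N : nat) (U : pset F N) : Prop :=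
  (forall v, U v -> v != 0) /\ zclosed (fun v : pt F N => v != 0 /\ ~ U v).

Definition zclosure (F : fieldType) (N : nat) (S : pset F N) : pset F N :=
  fun v => v != 0 /\
    forall Z : pset F N, zclosed Z -> (forall w, S w -> Z w) -> Z v.

Definition zdense (F : fieldType) (N : nat) (U : pset F N) : Prop :=
  forall v : pt F N, v != 0 -> zclosure U v.

Definition psubset (F : fieldType) (N : nat) (A B : pset F N) : Prop :=
  forall v, A v -> B v.

Definition zirreducible (F : fieldType) (N : nat) (Z : pset F N) : Prop :=
  zclosed Z /\ (exists v, Z v) /\
  forall Z1 Z2 : pset F N, zclosed Z1 -> zclosed Z2 ->
    (forall v, Z v -> Z1 v \/ Z2 v) -> psubset Z Z1 \/ psubset Z Z2.

Definition nondegenerate_var (F : fieldType) (N : nat) (X : pset F N) : Prop :=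
  forall a : 'cV[F]_(N.+1), a != 0 -> exists x, X x /\ x *m a != 0.

Definition in_span_of (F : fieldType) (N : nat) (X : pset F N) (p : pt F N)
    (r : nat) : Prop :=
  exists xs : 'I_r -> pt F N,
    (forall i, X (xs i)) /\
    (forall i j, i != j -> ~ exists c : F, xs j = c *: xs i) /\
    exists c : 'I_r -> F, p = \sum_(i < r) c i *: xs i.

Definition has_rank (F : fieldType) (N : nat) (X : pset F N) (p : pt F N)
    (j : nat) : Prop :=
  p != 0 /\ in_span_of X p j /\ forall r, (r < j)%N -> ~ in_span_of X p r.

Definition Wrank (F : fieldType) (N : nat) (X : pset F N) (j : nat) : pset F N :=
  zclosure (fun p => has_rank X p j).

Definition generic_rank (F : fieldType) (N : nat) (X : pset F N) (g : nat) : Prop :=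
  exists U : pset F N, zopen U /\ zdense U /\ forall v, U v -> has_rank X v g.

(* W contains a chain Z_0 < Z_1 < ... < Z_d of irreducible closed subsets,
   i.e. dim W >= d (Krull dimension of the Zariski topology). *)
Definition chain_in (F : fieldType) (N : nat) (W : pset F N) (d : nat) : Prop :=
  exists Zs : nat -> pset F N,
    (forall i, (i <= d)%N -> zirreducible (Zs i)) /\
    (forall i, (i < d)%N -> psubset (Zs i) (Zs i.+1) /\
                            exists v, Zs i.+1 v /\ ~ Zs i v) /\
    psubset (Zs d) W.

(* codim W >= c, where codim W = N - dim W, and codim of the empty set is
   +infinity. *)
Definition codim_ge (F : fieldType) (N : nat) (W : pset F N) (c : nat) : Prop :=
  (exists v, W v) -> forall d, chain_in W d -> (d + c <= N)%N.

(* Main.v *)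
Require Import Defs.
From HB Require Import structures.
From mathcomp Require Import all_boot all_order all_algebra.
From mathcomp Require Import mpoly zify.
From Stdlib Require Import Classical ClassicalEpsilon.
Set Implicit Arguments.
Unset Strict Implicit.
Unset Printing Implicit Defensive.
Import Order.TTheory GRing.Theory.
Local Open Scope ring_scope.

(* Let [R j] be the set of points of rank [j].  Adding a point of [X] changes
   the rank by at most one.  Hence, for [j > g], if [T] is an irreducible subset
   of [R j] of maximal dimension among those whose closure contains a given
   irreducible set, the join [T + X] lies in the closure of [R (j - 1)]: it
   cannot lie in that of [R j] by maximality, nor in that of [R (j + 1)], since
   joining once more with [X] would lead back to [R j].

   On the other hand, if [T + X] is not dense, then [T < T + F x < T + X] are
   strict inclusions of closures for some [x] in [X] (Adlandsvik): otherwise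
   [T + X] would be a cone with vertex [x] for general, hence for every, [x] in
   [X], and so the whole space because [X] spans.  Each step from [R j] to
   [R (j - 1)] thus gains two dimensions, and the last one, from [R (g + 1)] to
   the whole space, gains one.

   Here [S < T] compares closures of arbitrary subsets of the affine space
   [F^(N+1)]; the sets [T] need not be cones. *)

(** * Noetherianity of polynomial rings *)

(* In dimension [n.+1], the exponents whose last entry is at least [M] are
   handled by the basis in dimension [n]; each smaller last entry separately. *)
Lemma dickson (U : eqType) (phi : U -> nat -> nat) n (A : U -> Prop) :
  exists s : seq U, (forall b, b \in s -> A b) /\
    forall a, A a -> exists2 b, b \in s & forall i, (i < n)%N -> (phi b i <= phi a i)%N.
Proof.
elim: n A => [|n IH] A.
  have [[a Aa]|nA] := classic (exists a, A a); last first.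
    by exists [::]; split=> // a Aa; case: nA; exists a.
  by exists [:: a]; split=> [b|b _]; [rewrite inE => /eqP-> | exists a; rewrite ?inE].
have [s [sA hs]] := IH A; pose M := \max_(b <- s) phi b n.
have [t [tA ht]] : exists t : seq U, (forall b, b \in t -> A b) /\
    forall a, A a -> (phi a n < M)%N ->
      exists2 b, b \in t & forall i, (i < n.+1)%N -> (phi b i <= phi a i)%N.
  elim: {s sA hs} M => [|M [t [tA ht]]]; first by exists [::].
  have [u [uA hu]] := IH (fun a => A a /\ phi a n = M).
  exists (t ++ u); split=> [b|a Aa].
    by rewrite mem_cat => /orP[/tA|/uA[]].
  rewrite ltnS leq_eqVlt => /orP[/eqP aM|/(ht a Aa)[b bt hb]]; last first.
    by exists b; rewrite // mem_cat bt.
  have [b bu hb] := hu a (conj Aa aM); exists b; first by rewrite mem_cat bu orbT.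
  move=> i; rewrite ltnS leq_eqVlt => /orP[/eqP->|/hb //].
  by have [_ ->] := uA b bu; rewrite aM.
exists (s ++ t); split=> [b|a Aa]; first by rewrite mem_cat => /orP[/sA|/tA].
have [/(ht a Aa)[b bt hb]|leM] := ltnP (phi a n) M.
  by exists b; rewrite // mem_cat bt orbT.
have [b bs hb] := hs a Aa; exists b; first by rewrite mem_cat bs.
move=> i; rewrite ltnS leq_eqVlt => /orP[/eqP->|/hb //].
by apply: leq_trans leM; apply: leq_bigmax_seq.
Qed.

Section Noetherian.

Variables (K : fieldType) (n : nat).
Implicit Types (f g p q : {mpoly K[n]}) (I J : {mpoly K[n]} -> Prop).

Definition ideal I := I 0 /\ forall q f g, I f -> I g -> I (q * f + g).

(** Dickson's lemma picks [s] so that every leading monomial of [I] is divisible by one from [s];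
    subtracting a monomial multiple of an element of [s] lowers the leading monomial. That [s]
    generates [I] is expressed through the ideals [J] containing [s], without explicit
    coefficients. *)
Lemma hilbert_basis I : ideal I -> exists s : seq {mpoly K[n]},
  (forall g, g \in s -> I g) /\
  forall J, ideal J -> (forall g, g \in s -> J g) -> forall f, I f -> J f.
Proof.
move=> [I0 ID]; pose phi f i := if insub i is Some j then mlead f (j : 'I_n) else 0%N.
have [s [sI hs]] := dickson phi n (fun f => f != 0 /\ I f).
exists s; split=> [g /sI[] //|J [J0 JD] sJ].
elim/mleadrect => f IH If; have [->//|f0] := eqVneq f 0.
have [g gs hg] := hs f (conj f0 If); have [g0 Ig] := sI g gs.
have le_gf : (mlead g <= mlead f)%MM.
  by apply/mnm_lepP => i; have := hg i (ltn_ord i); rewrite /phi valK.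
pose q : {mpoly K[n]} := (mleadc f / mleadc g) *: 'X_[mlead f - mlead g].
have c0 : mleadc f / mleadc g != 0 by rewrite mulf_neq0 ?invr_eq0 ?mleadc_eq0.
have q0 : q != 0 by rewrite mscalerI (negPf c0) -msize_poly_eq0 msizeX.
have mqg : mlead (q * g) = mlead f.
  by rewrite mleadM // mleadZ // mleadXm submK.
have cqg : (q * g)@_(mlead f) = mleadc f.
  have := mleadcM q g; rewrite -mleadM // mqg => ->.
  by rewrite mleadZ // mleadXm mcoeffZ mcoeffX eqxx mulr1 divfK ?mleadc_eq0.
have -> : f = q * g + (- q * g + f) by rewrite mulNr addNKr.
apply: (JD _ _ _ (sJ g gs)).
have Ir : I (- q * g + f) by apply: ID.
have [->//|r0] := eqVneq (- q * g + f) 0; apply: IH => //.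
rewrite mulNr addrC in r0 *; rewrite lt_neqAle; apply/andP; split.
  apply: contra r0 => /eqP e; rewrite -mleadc_eq0 e mcoeffB cqg.
  by rewrite subrr.
by apply: le_trans (mleadB_le _ _) _; rewrite leUx mqg lexx.
Qed.

End Noetherian.

(** * Irreducible sets and dimension *)

Section Zariski.

Variables (F : closedFieldType) (N : nat).
Implicit Types (S T R A B X Z : pset F N) (p q f h : {mpoly F[N.+1]}).
Implicit Types (u v w x : pt F N).

Lemma evD p q v : ev (p + q) v = ev p v + ev q v.
Proof. exact: mevalD. Qed.

Lemma evM p q v : ev (p * q) v = ev p v * ev q v.
Proof. exact: mevalM. Qed.

Lemma evX p k v : ev (p ^+ k) v = ev p v ^+ k.
Proof. exact: rmorphXn. Qed.

Lemma ev_sum (I : finType) (P : pred I) (G : I -> {mpoly F[N.+1]}) v :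
  ev (\sum_(i | P i) G i) v = \sum_(i | P i) ev (G i) v.
Proof. exact: raddf_sum. Qed.

Definition vanishes S p := forall v, S v -> ev p v = 0.

(* The affine Zariski closure of [S] is contained in that of [T]. *)
Definition zle S T := forall p, vanishes T p -> vanishes S p.

(** The vanishing ideal of [S] is prime; nonemptiness makes it proper. *)
Definition irr S :=
  (exists v, S v) /\
  forall p q, vanishes S (p * q) -> vanishes S p \/ vanishes S q.

Lemma zle_sub S T : psubset S T -> zle S T.
Proof. by move=> sST p hp v /sST /hp. Qed.

Lemma zle_trans S T R : zle S T -> zle T R -> zle S R.
Proof. by move=> hST hTR p /hTR /hST. Qed.

Lemma not_zle S T : ~ zle S T ->
  exists f v, vanishes T f /\ S v /\ ev f v != 0.
Proof.
move=> nST; apply: NNPP => nex; apply: nST => p pT v Sv.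
by apply/eqP/negP => /negP pv; apply: nex; exists p, v.
Qed.

Lemma irr_vanishesX S f k : irr S -> vanishes S (f ^+ k) -> vanishes S f.
Proof.
move=> [[v Sv] prS]; elim: k => [/(_ v Sv) /eqP|k IH].
  by rewrite evX expr0 oner_eq0.
by rewrite exprS => /prS[].
Qed.

Lemma irr_eqv S T : zle S T -> zle T S -> irr S -> irr T.
Proof.
move=> hST hTS [[v Sv] prS]; split.
  apply: NNPP => nT.
  have /(_ v Sv)/eqP : vanishes S 1 by apply: hST => w Tw; case: nT; exists w.
  by rewrite [ev _ _]meval1 oner_eq0.
by move=> p q /hST /prS [] /hTS; [left|right].
Qed.

(* A chain of [n] strict inclusions of irreducible closed sets ends at the
   closure of [S]. *)
Fixpoint chain (n : nat) S : Prop :=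
  irr S /\ if n is m.+1 then exists T, chain m T /\ zle T S /\ ~ zle S T
           else True.

Lemma chain_irr n S : chain n S -> irr S.
Proof. by case: n => [|n] []. Qed.

Lemma chain_le n S T : chain n S -> zle S T -> irr T -> chain n T.
Proof.
case: n => [|n] //= [_ [T0 [c0 [le0 nle0]]]] hST irT; split=> //.
exists T0; split=> //; split; first exact: zle_trans le0 hST.
by move=> hT; apply: nle0; apply: zle_trans hST hT.
Qed.

Lemma chain_lt n S T : chain n S -> zle S T -> ~ zle T S -> irr T -> chain n.+1 T.
Proof. by move=> cS hST nTS irT; split=> //; exists S. Qed.

(** * Bounding chains by counting independent functions *)

Definition lin_free_on S (I : finType) (h : I -> {mpoly F[N.+1]}) :=
  forall c : I -> F, vanishes S (\sum_i c i *: h i) -> forall i, c i = 0.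

(* Dividing by the largest power of [f] and then setting [f = 0] isolates the
   lowest coefficient. *)
Lemma lin_free_pow S T f (I : finType) (h : I -> {mpoly F[N.+1]}) m :
  irr S -> zle T S -> vanishes T f -> ~ vanishes S f -> lin_free_on T h ->
  lin_free_on S (fun ik : I * 'I_m => h ik.1 * f ^+ ik.2).
Proof.
move=> irS hTS fT nfS frT c.
pose G (k : 'I_m) : {mpoly F[N.+1]} := \sum_i c (i, k) *: h i.
have -> : \sum_ik c ik *: (h ik.1 * f ^+ ik.2) = \sum_k G k * f ^+ k.
  under [RHS]eq_bigr => k _ do rewrite mulr_suml.
  rewrite exchange_big pair_bigA /=.
  by apply: eq_bigr => -[i k] _ /=; rewrite scalerAl.
move=> hG.
suff G0 : forall k, vanishes T (G k).
  by case=> i k; apply: (frT (fun i => c (i, k)) (G0 k)).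
suff G0 : forall n (k : 'I_m), (k < n)%N -> vanishes T (G k).
  by move=> k; apply: (G0 k.+1).
elim=> // n IH k; rewrite ltnS leq_eqVlt => /orP[/eqP kn|]; last exact: IH.
have Gz (l : 'I_m) : (l < k)%N -> G l = 0.
  rewrite kn => /IH /(frT (fun i => c (i, l))) cz.
  by rewrite /G big1 // => i _; rewrite cz scale0r.
(* The coefficients below [k] are already zero, so [f ^+ k] factors out; primality then kills the
   cofactor on [S], and on [T] it reduces to [G k]. *)
have eG : \sum_l G l * f ^+ l =
    f ^+ k * (G k + f * \sum_(l : 'I_m | (k < l)%N) G l * f ^+ (l - k.+1)).
  rewrite (bigD1 k) //= mulrDr [f ^+ k * G k]mulrC; congr (_ + _).
  rewrite mulrA -exprSr mulr_sumr [RHS]big_mkcond [LHS]big_mkcond /=.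
  apply: eq_bigr => l _; case: ltngtP => [kl|lk|/val_inj ->]; rewrite ?eqxx //.
  - rewrite ifT; last by apply: contraTneq kl => ->; rewrite ltnn.
    by rewrite mulrCA -exprD subnKC.
  - by rewrite (Gz l lk) mul0r if_same.
move: hG; rewrite eG => /(proj2 irS)[/(irr_vanishesX irS)/nfS //|/hTS hT].
by move=> v Tv; have := hT v Tv; rewrite evD evM (fT v Tv) mul0r addr0.
Qed.

Lemma msizeM_pred p q : (msize (p * q) <= (msize p + msize q).-1)%N.
Proof.
have [->|p0] := eqVneq p 0; first by rewrite mul0r msize0.
have [->|q0] := eqVneq q 0; first by rewrite mulr0 msize0.
by rewrite msizeM.
Qed.

(** A lower bound on the Hilbert function of [S]: each strict inclusion multiplies the family by [m]
    powers of some [f] vanishing on the smaller set only, at a cost in degree linear in [m]. *)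
Lemma chain_family n S : chain n S -> exists E, forall m,
  exists (I : finType) (h : I -> {mpoly F[N.+1]}),
    [/\ #|I| = (m ^ n)%N, forall i, (msize (h i) <= (m * E).+1)%N & lin_free_on S h].
Proof.
elim: n S => [|n IH] S /= [irS].
  move=> _; exists 0%N => m; exists unit, (fun=> 1); split.
  - by rewrite card_unit expn0.
  - by move=> _; rewrite msize1.
  move=> c; have [[v Sv] _] := irS => /(_ v Sv).
  rewrite (big_pred1 tt); last by case.
  by rewrite -mul_mpolyC mulr1 /ev mevalC => cz [].
move=> [T [cT [leTS /not_zle [f [w [fT [Sw fw]]]]]]].
have [E hE] := IH T cT; exists (E + msize f)%N => m.
have [I [h [cI sh fr]]] := hE m.
exists (I * 'I_m)%type, (fun ik : I * 'I_m => h ik.1 * f ^+ ik.2); split.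
- by rewrite card_prod card_ord cI expnSr.
- move=> [i k] /=; apply: leq_trans (msizeM_pred _ _) _.
  have sX (l : nat) : (msize (f ^+ l) <= (l * msize f).+1)%N.
    elim: l => [|l IHl]; first by rewrite expr0 msize1.
    rewrite exprS; apply: leq_trans (msizeM_pred _ _) _.
    by rewrite mulSn; have := leq_add (leqnn (msize f)) IHl; lia.
  have := sX k; have := sh i; have : (k * msize f <= m * msize f)%N.
    by rewrite leq_mul2r (ltnW (ltn_ord k)) orbT.
  by rewrite mulnDr; lia.
- apply: (lin_free_pow irS leTS fT _ fr) => /(_ w Sw) /eqP.
  by rewrite (negPf fw).
Qed.

Lemma lin_free_card S (I : finType) (h : I -> {mpoly F[N.+1]}) D :
  lin_free_on S h -> (forall i, (msize (h i) <= D.+1)%N) ->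
  (#|I| <= D.+1 ^ N.+1)%N.
Proof.
move=> fr sh; pose J : finType := {ffun 'I_N.+1 -> 'I_D.+1}.
have <- : #|J| = (D.+1 ^ N.+1)%N by rewrite card_ffun !card_ord.
rewrite leqNgt; apply/negP => ltJI.
(* Coefficient matrix, with columns indexed by a box of exponents containing all monomials of degree
   at most [D]. More rows than columns force a linear relation. *)
pose A : 'M[F]_(#|I|, #|J|) :=
  \matrix_(i, j) (h (enum_val i))@_[multinom ((enum_val j : J) k : nat) | k < N.+1].
have /rowV0Pn [u] : kermx A != 0.
  rewrite -mxrank_eq0 mxrank_ker subn_eq0 -ltnNge.
  by apply: leq_ltn_trans (rank_leq_col A) ltJI.
move=> /sub_kermxP uA; case/negP; apply/eqP/rowP => i; rewrite mxE.
rewrite -[i]enum_valK; apply: (fr (fun i => u 0 (enum_rank i))) => v _.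
rewrite (_ : \sum_i _ = 0) ?[ev 0 v]meval0 //; apply/mpolyP => m.
rewrite mcoeff0 raddf_sum /=.
have [mD|] := boolP [forall k, (m k < D.+1)%N].
  pose j : J := [ffun k => Ordinal (forallP mD k)].
  have /rowP /(_ (enum_rank j)) := uA; rewrite !mxE => e0.
  rewrite -[RHS]e0 (reindex (@enum_val I predT)) /=; last exact/onW_bij/enum_val_bij.
  apply: eq_bigr => l _; rewrite mcoeffZ enum_valK mxE enum_rankK.
  by congr (_ * _@__); apply/mnmP => k; rewrite mnmE ffunE.
rewrite negb_forall => /existsP [k]; rewrite -leqNgt => mk.
apply: big1 => l _; rewrite mcoeffZ memN_msupp_eq0 ?mulr0 //.
apply: msize_mdeg_ge; apply: leq_trans (sh l) _; apply: leq_trans mk _.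
by rewrite mdegE (bigD1 k) //= leq_addr.
Qed.

Lemma chain_bound n S : chain n S -> (n <= N.+1)%N.
Proof.
move=> /chain_family [E hE]; rewrite leqNgt; apply/negP => ltn.
(* Least [m] for which [m ^ N.+2] exceeds [(m * E.+1) ^ N.+1]. *)
pose m := (E.+1 ^ N.+1).+1.
have [I [h [cI sh fr]]] := hE m.
have := lin_free_card fr sh; rewrite cI; apply/negP; rewrite -ltnNge.
apply: (@leq_ltn_trans ((m * E.+1) ^ N.+1)).
  by rewrite leq_exp2r // mulnS /m; lia.
apply: (@leq_trans (m ^ N.+2)); last by rewrite leq_pexp2l.
by rewrite expnMn [ltnRHS]expnSr ltn_pmul2l ?expn_gt0.
Qed.

(** * Noetherian descent and irreducible subsets *)

(** The increasing union of the vanishing ideals is finitely generated, so some stage already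
    contains the generators. *)
Lemma no_descending_closures (T : nat -> pset F N) :
  (forall k, psubset (T k.+1) (T k)) ->
  exists k, forall p, vanishes (T k.+1) p -> vanishes (T k) p.
Proof.
move=> dec.
have mono i j : (i <= j)%N -> psubset (T j) (T i).
  move=> /subnKC <-; elim: (j - i)%N => [|l IH] v; first by rewrite addn0.
  by rewrite addnS => /dec /IH.
have I_ideal : ideal (fun p => exists k, vanishes (T k) p).
  split; first by exists 0%N => v _; rewrite [ev _ _]meval0.
  move=> q f g [i hf] [j hg]; exists (maxn i j) => v hv.
  rewrite evD evM (hf v) ?(hg v) ?mulr0 ?addr0 //.
    exact: mono (leq_maxr i j) _ hv.
  exact: mono (leq_maxl i j) _ hv.
have [s [sI hs]] := hilbert_basis I_ideal.
have [k hk] : exists k, forall g, g \in s -> vanishes (T k) g.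
  elim: s sI {hs} => [|g s IH] sI; first by exists 0%N.
  have [|i hi] := IH; first by move=> h hsh; apply: sI; rewrite inE hsh orbT.
  have [|j hj] := sI g; first by rewrite inE eqxx.
  exists (maxn i j) => h; rewrite inE => /predU1P[->|/hi hh] v /mono hv.
    exact: hj (hv _ (leq_maxr _ _)).
  exact: hh (hv _ (leq_maxl _ _)).
exists k => p hp; apply: (hs (vanishes (T k))) => //; last by exists k.+1.
split=> [v _|q f g hf hg v Tv]; first by rewrite [ev _ _]meval0.
by rewrite evD evM hf // hg // mulr0 addr0.
Qed.

Lemma irr_cover S A B : irr S -> zle S (fun v => A v \/ B v) -> zle S A \/ zle S B.
Proof.
move=> [_ prS] hS; apply: NNPP => /not_or_and [/not_zle [p [v [pA [Sv pv]]]]].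
move=> /not_zle [q [w [qB [Sw qw]]]].
have : vanishes S (p * q).
  by apply: hS => u [/pA|/qB] e; rewrite evM e ?mul0r ?mulr0.
move/prS => [/(_ v Sv) e|/(_ w Sw) e]; first by rewrite e eqxx in pv.
by rewrite e eqxx in qw.
Qed.

(** Turns inclusion in a closure into an actual irreducible subset of [R]. A reducible candidate
    splits into two zero loci, one of which still has [S] in its closure; never reaching an
    irreducible one would give an infinite strict descent. *)
Lemma irr_sub_dense S R : irr S -> zle S R ->
  exists T, [/\ psubset T R, irr T & zle S T].
Proof.
move=> irS leSR; apply: NNPP => noT.
pose U := {T : pset F N | psubset T R /\ zle S T}.
have next (T : U) : {T' : U | psubset (sval T') (sval T) /\
    exists p, vanishes (sval T') p /\ ~ vanishes (sval T) p}.
  apply: constructive_indefinite_description.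
  case: T => T [sTR leST] /=.
  have [v Sv] := proj1 irS.
  have exT : exists v, T v.
    apply: NNPP => nT.
    have /(_ v Sv)/eqP : vanishes S 1 by apply: leST => w Tw; case: nT; exists w.
    by rewrite [ev _ _]meval1 oner_eq0.
  have : ~ irr T by move=> irT; apply: noT; exists T.
  move=> nirT; have [p [q [pq [np nq]]]] : exists p q,
      vanishes T (p * q) /\ ~ vanishes T p /\ ~ vanishes T q.
    apply: NNPP => no; apply: nirT; split=> // p q pq.
    by apply: NNPP => /not_or_and [np nq]; apply: no; exists p, q.
  have : zle S (fun v => (T v /\ ev p v = 0) \/ (T v /\ ev q v = 0)).
    apply: zle_trans leST _; apply: zle_sub => w Tw.
    have /eqP := pq w Tw; rewrite evM mulf_eq0 => /orP[] /eqP e; [left|right];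
      by split.
  have build f : ~ vanishes T f -> zle S (fun v => T v /\ ev f v = 0) ->
      exists T' : U, psubset (sval T') T /\
        exists p, vanishes (sval T') p /\ ~ vanishes T p.
    move=> nf leS'.
    have hU : psubset (fun v => T v /\ ev f v = 0) R /\
              zle S (fun v => T v /\ ev f v = 0).
      by split=> // w [/sTR].
    exists (exist (fun T' => psubset T' R /\ zle S T') _ hU).
    by split=> [w []|] //=; exists f; split=> // w [].
  by case/(irr_cover irS); apply: build.
have U0 : U by exists R; split.
pose T := fix T k : U := if k is l.+1 then sval (next (T l)) else U0.
have [|k hk] := @no_descending_closures (fun k => sval (T k)).
  by move=> k /=; case: (next (T k)) => T' [].
move: hk => /=; case: (next (T k)) => T' [_ [p [pT' npT]]] /= /(_ p pT').
exact: npT.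
Qed.

(** * Joins and cones *)

Definition transl x p : {mpoly F[N.+1]} :=
  p \mPo [tuple 'X_i + (x ord0 i)%:MP | i < N.+1].

Lemma ev_transl x p v : ev (transl x p) v = ev p (v + x).
Proof.
rewrite /ev comp_mpoly_meval; apply: meval_eq => i.
by rewrite tnth_mktuple mevalD mevalXU mevalC mxE.
Qed.

Lemma not_vanishes S p : ~ vanishes S p -> exists2 v, S v & ev p v != 0.
Proof.
move=> np; apply: NNPP => no; apply: np => v Sv.
by apply/eqP; apply: contraT => pv; case: no; exists v.
Qed.

Lemma irr_meet S p q v w : irr S -> S v -> ev p v != 0 -> S w -> ev q w != 0 ->
  exists u, [/\ S u, ev p u != 0 & ev q u != 0].
Proof.
move=> [_ prS] Sv pv Sw qw; apply: NNPP => no.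
have /prS[] : vanishes S (p * q).
- move=> u Su; apply/eqP; apply: contraT; rewrite evM mulf_eq0 negb_or.
  by case/andP=> pu qu; case: no; exists u.
- by move/(_ v Sv) => e; rewrite e eqxx in pv.
- by move/(_ w Sw) => e; rewrite e eqxx in qw.
Qed.

Definition padd A B : pset F N := fun v => exists a b, [/\ A a, B b & v = a + b].

Definition pline x : pset F N := fun v => exists c : F, v = c *: x.

(** One summand moves at a time: a common [b2] keeps [p] nonzero at [a0 + b2] and [q] at [a1 + b2],
    then a common [a2] replaces [a0] and [a1]. *)
Lemma irr_padd A B : irr A -> irr B -> irr (padd A B).
Proof.
move=> irA irB; have [[a Aa] prA] := irA; have [[b Bb] _] := irB.
split=> [|p q pq]; first by exists (a + b), a, b.
apply: NNPP => /not_or_and [].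
move=> /not_vanishes [_ [a0 [b0 [Aa0 Bb0 ->]]] pab].
move=> /not_vanishes [_ [a1 [b1 [Aa1 Bb1 ->]]] qab].
have [||b2 [Bb2]] := @irr_meet B (transl a0 p) (transl a1 q) b0 b1 irB Bb0 _ Bb1.
- by rewrite ev_transl addrC.
- by rewrite ev_transl addrC.
rewrite !ev_transl ![b2 + _]addrC -!(ev_transl b2) => pa0 qa1.
have [a2 [Aa2]] := irr_meet irA Aa0 pa0 Aa1 qa1.
rewrite !ev_transl => pa2 qa2.
have /eqP : ev (p * q) (a2 + b2) = 0 by apply: pq; exists a2, b2.
by rewrite evM mulf_eq0 (negPf pa2) (negPf qa2).
Qed.

Lemma zle_padd S T A : zle S T -> zle (padd S A) (padd T A).
Proof.
move=> leST p pTA v [s [a [Ss Aa ->]]].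
rewrite -ev_transl; apply: (leST (transl a p)) => // t Tt.
by rewrite ev_transl; apply: pTA; exists t, a.
Qed.

Lemma ev_homog p d v (t : F) : p \is d.-homog -> ev p (t *: v) = t ^+ d * ev p v.
Proof.
move=> /dhomogP hp; rewrite /ev !mevalE mulr_sumr.
apply: eq_big_seq => m /hp <-; rewrite mulrCA; congr (_ * _).
under eq_bigr => i _ do rewrite mxE exprMn.
by rewrite big_split /= prodrXr mdegE.
Qed.

(** The restriction of [p] to the line through the origin and [v]; its coefficients are the values
    at [v] of the homogeneous components of [p]. *)
Definition ray p v : {poly F} := \poly_(d < msize p) ev (pihomog mdeg d p) v.

Lemma ray_horner p v t : (ray p v).[t] = ev p (t *: v).
Proof.
rewrite horner_poly [in RHS](pihomog_partitionE (leqnn (msize p))) ev_sum.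
by apply: eq_bigr => d _; rewrite (ev_homog _ _ (pihomogP _ _ _)) mulrC.
Qed.

Lemma coef_ray p v d : (ray p v)`_d = ev (pihomog mdeg d p) v.
Proof.
rewrite coef_poly; case: ltnP => // le_pd.
rewrite pihomogE big_seq_cond big1 ?[ev _ _]meval0 //.
move=> m /andP[/msize_mdeg_lt lt_m /eqP em].
by rewrite em ltnNge le_pd in lt_m.
Qed.

Lemma poly_nonroot (P : {poly F}) : P != 0 -> exists2 t, t != 0 & P.[t] != 0.
Proof.
(* The factor ['X] makes the nonroot nonzero. *)
move=> P0; have /closed_nonrootP [t] : 'X * P != 0 by rewrite mulf_neq0 ?polyX_eq0.
by rewrite rootE hornerM hornerX mulf_eq0 negb_or => /andP[]; exists t.
Qed.

Lemma ray_eq0 p v : (forall t, t != 0 -> ev p (t *: v) = 0) -> ray p v = 0.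
Proof.
move=> pv; apply/eqP; apply: contraT => /poly_nonroot [t t0].
by rewrite ray_horner pv ?eqxx.
Qed.

Lemma irr_pline x : irr (pline x).
Proof.
split=> [|p q pq]; first by exists x, 1; rewrite scale1r.
have /eqP : ray p x * ray q x = 0.
  apply/eqP; apply: contraT => /poly_nonroot [t _].
  by rewrite hornerM !ray_horner -evM pq ?eqxx //; exists t.
by rewrite mulf_eq0 => /orP[] /eqP e; [left|right] => _ [t ->];
  rewrite -ray_horner e horner0.
Qed.

Lemma irr_full : irr (fun _ : pt F N => True).
Proof.
split=> [|p q pq]; first by exists 0.
apply: NNPP => /not_or_and [/not_vanishes [v _ pv] /not_vanishes [w _ qw]].
(* Restriction to the line from [v] (at 0) to [w] (at 1). *)
have : ray (transl v p) (w - v) * ray (transl v q) (w - v) != 0.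
  rewrite mulf_neq0 //; apply/eqP => /(congr1 (fun P : {poly F} => horner P _)).
    move=> /(_ 0); rewrite ray_horner ev_transl scale0r add0r horner0.
    by move/eqP; rewrite (negPf pv).
  move=> /(_ 1); rewrite ray_horner ev_transl scale1r subrK horner0.
  by move/eqP; rewrite (negPf qw).
case/poly_nonroot => t _; rewrite hornerM mulf_eq0 negb_or => /andP[pt qt].
rewrite ray_horner ev_transl in pt; rewrite ray_horner ev_transl in qt.
have /eqP := pq (t *: (w - v) + v) I.
by rewrite evM mulf_eq0 (negPf pt) (negPf qt).
Qed.

(** * Projective closed sets as affine cones *)

Definition scalable_set S := forall (c : F) v, c != 0 -> S v -> S (c *: v).

Lemma zclosed_scalable Z : zclosed Z -> scalable_set Z.
Proof.
move=> [E [homE hZ]] c v c0 /hZ [v0 Ev]; apply/hZ; split.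
  by rewrite scaler_eq0 negb_or c0.
by move=> p Ep; have [d /(ev_homog v c) ->] := homE p Ep; rewrite Ev // mulr0.
Qed.

Lemma zclosed_neq0 Z v : zclosed Z -> Z v -> v != 0.
Proof. by move=> [E [_ hZ]] /hZ[]. Qed.

Lemma zclosed_zero_locus p d : p \is d.-homog ->
  zclosed (fun v : pt F N => v != 0 /\ ev p v = 0).
Proof.
move=> hp; exists (eq p); split=> [_ <-|v]; first by exists d.
split=> -[v0 pv]; split=> //; last exact: pv.
by move=> _ <-.
Qed.

(* Projective irreducibility, which concerns homogeneous polynomials only, gives
   a point where a component of [p] and a component of [q] are both nonzero;
   then [p * q] is not identically zero on the line through it. *)
Lemma zirreducible_irr Z : zirreducible Z -> irr Z.
Proof.
move=> [cZ [exZ prZ]]; split=> // p q pq.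
apply: NNPP => /not_or_and [np nq].
have comp f : ~ vanishes Z f -> exists d, ~ vanishes Z (pihomog mdeg d f).
  move=> nf; apply: NNPP => no; apply: nf => v Zv.
  rewrite -[v]scale1r -ray_horner (_ : ray f v = 0) ?horner0 //.
  apply/polyP => d; rewrite coef_ray coef0.
  by apply: NNPP => nz; apply: no; exists d => /(_ v Zv).
have [[d hd] [e he]] := (comp p np, comp q nq).
have [v Zv nz] : exists2 v, Z v &
    ev (pihomog mdeg d p) v != 0 /\ ev (pihomog mdeg e q) v != 0.
  apply: NNPP => no.
  have cover v : Z v -> (v != 0 /\ ev (pihomog mdeg d p) v = 0) \/
                        (v != 0 /\ ev (pihomog mdeg e q) v = 0).
    move=> Zv; have v0 := zclosed_neq0 cZ Zv.
    have [->|pv] := eqVneq (ev (pihomog mdeg d p) v) 0; first by left.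
    have [->|qv] := eqVneq (ev (pihomog mdeg e q) v) 0; first by right.
    by case: no; exists v.
  have cp := zclosed_zero_locus (pihomogP mdeg d p).
  have cq := zclosed_zero_locus (pihomogP mdeg e q).
  case: (prZ _ _ cp cq cover) => sub.
    by apply: hd => v /sub[].
  by apply: he => v /sub[].
case: nz; rewrite -!coef_ray => pv qv.
have : ray p v * ray q v != 0.
  by rewrite mulf_neq0 //; [apply: contraNneq pv|apply: contraNneq qv] => ->;
    rewrite coef0.
case/poly_nonroot => t t0; rewrite hornerM !ray_horner -evM pq ?eqxx //.
exact: zclosed_scalable cZ _ _ t0 Zv.
Qed.

(** The projective closure tests homogeneous polynomials only, but if [p] vanishes on a cone, so do
    all its homogeneous components. *)
Lemma zclosure_zle S : scalable_set S -> (forall v, S v -> v != 0) ->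
  zle (zclosure S) S.
Proof.
move=> scS S0 p pS v [v0 hv].
rewrite -[v]scale1r -ray_horner (_ : ray p v = 0) ?horner0 //.
apply/polyP => d; rewrite coef_ray coef0.
apply: (proj2 (hv _ (zclosed_zero_locus (pihomogP mdeg d p)) _)) => w Sw.
split; first exact: S0.
rewrite -coef_ray ray_eq0 ?coef0 // => t t0.
by apply: pS; apply: scS.
Qed.

Lemma zclosed_not_zle Z Z' v : zclosed Z -> zclosed Z' -> Z' v -> ~ Z v -> ~ zle Z' Z.
Proof.
move=> [E [_ hZ]] cZ' Z'v nZv le; apply: nZv; apply/hZ.
split=> [|p Ep]; first exact: zclosed_neq0 Z'v.
by apply: (le p) => // w /hZ[_]; apply.
Qed.

(** * Joins with a spanning cone *)

Lemma nondegenerate_span X : nondegenerate_var X -> forall u : pt F N,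
  exists (m : nat) (A : 'M[F]_(m, N.+1)) (c : 'I_m -> F),
    (forall i, X (row i A)) /\ u = \sum_i c i *: row i A.
Proof.
move=> ndX; have full r : (r <= N.+1)%N -> exists (m : nat) (A : 'M[F]_(m, N.+1)),
    (forall i, X (row i A)) /\ (r <= \rank A)%N.
  elim: r => [|r IH] ltr; first by exists 0%N, 0; split=> // -[].
  have [m [A [XA rA]]] := IH (ltnW ltr).
  have [ltrA|leAr] := ltnP r (\rank A); first by exists m, A.
  have rkA : \rank A = r by apply/eqP; rewrite eqn_leq leAr.
  (* A hyperplane through all the rows; a point of [X] off it raises the rank. *)
  have [a a0 Aa] : exists2 a : 'cV[F]_N.+1, a != 0 & A *m a = 0.
    have : kermx A^T != 0.
      by rewrite -mxrank_eq0 mxrank_ker mxrank_tr rkA subn_eq0 -ltnNge.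
    case/rowV0Pn => b /sub_kermxP bA b0; exists b^T; first by rewrite trmx_eq0.
    by apply: trmx_inj; rewrite trmx_mul trmxK bA trmx0.
  have [x [Xx xa]] := ndX a a0.
  exists (m + 1)%N, (col_mx A x); split=> [i|].
    rewrite -[i]splitK; case: (split i) => j /=.
      by rewrite rowKu.
    by rewrite rowKd (_ : row j x = x) //; apply/rowP => k; rewrite mxE (ord1 j).
  rewrite -rkA -addsmxE ltn_neqAle mxrankS ?addsmxSl // andbT.
  apply: contraNneq xa => /eqP.
  rewrite (mxrank_leqif_sup (addsmxSl A x)) => /(submx_trans (addsmxSr A x)).
  by case/submxP => D ->; rewrite -mulmxA Aa mulmx0.
have [m [A [XA]]] := full N.+1 (leqnn _); rewrite col_leq_rank => fA u.
have [D ->] := submxP (submx_full u fA).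
exists m, A, (D ord0); split=> //; apply/rowP => j.
by rewrite mxE summxE; apply: eq_bigr => i _; rewrite !mxE.
Qed.

(* The translations preserving the closure of [S] form a group, so they are
   all of them as soon as they contain a spanning cone. *)
Lemma translation_stable_dense X S : scalable_set X -> nondegenerate_var X ->
  (exists v, S v) -> zle (padd S X) S -> zle (fun=> True) S.
Proof.
move=> scX ndX [s Ss] leS.
pose stab u := forall p, vanishes S p -> forall v, S v -> ev p (v + u) = 0.
have stab0 : stab 0 by move=> p pS v Sv; rewrite addr0 pS.
have stabD u w : stab u -> stab w -> stab (u + w).
  move=> su sw p pS v Sv; rewrite addrA -ev_transl; apply: su => // v' Sv'.
  by rewrite ev_transl; apply: sw.
have stabX c x : X x -> stab (c *: x).
  have [->|c0] := eqVneq c 0; first by rewrite scale0r.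
  by move=> Xx p pS v Sv; apply: (leS p pS); exists v, (c *: x); split=> //; apply: scX.
have stabT u : stab u.
  have [m [A [c [XA ->]]]] := nondegenerate_span ndX u.
  by apply: (big_ind stab) => // i _; apply: stabX.
by move=> p pS v _; have := stabT (v - s) p pS s Ss; rewrite addrC subrK.
Qed.

(** [v] is the limit of [v + t *: x] as [t] tends to 0; the cone [X] need not contain the origin
    itself. *)
Lemma zle_cone_padd X T : irr X -> scalable_set X -> zle T (padd T X).
Proof.
move=> [[x Xx] _] scX p pTX v Tv.
have : ray (transl v p) x = 0.
  apply: ray_eq0 => t t0; rewrite ev_transl addrC; apply: pTX.
  by exists v, (t *: x); split=> //; apply: scX.
move/(congr1 (fun P : {poly F} => P.[0])); rewrite ray_horner horner0 ev_transl.
by rewrite scale0r add0r.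
Qed.

Lemma chain_padd_line X T n : irr X -> scalable_set X -> nondegenerate_var X ->
  ~ zle (fun=> True) (padd T X) -> chain n T -> chain n.+2 (padd T X).
Proof.
move=> irX scX ndX ndense cT; have irT := chain_irr cT.
have irTX := irr_padd irT irX.
have leTX : zle T (padd T X) by apply: zle_cone_padd.
have leline x : X x -> zle (padd T (pline x)) (padd T X).
  move=> Xx p pTX _ [v [_ [Tv [c ->] ->]]].
  have [->|c0] := eqVneq c 0; first by rewrite scale0r addr0 (leTX p).
  by apply: pTX; exists v, (c *: x); split=> //; apply: scX.
apply: NNPP => nchain; apply: ndense.
apply: (translation_stable_dense scX ndX (proj1 irTX)).
(* Otherwise [T], [T + F x] and [T + X] would extend the chain by two. *)
have dicho x : X x -> zle (padd T (pline x)) T \/ zle (padd T X) (padd T (pline x)).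
  move=> Xx; apply: NNPP => /not_or_and [h1 h2]; apply: nchain.
  have leT : zle T (padd T (pline x)).
    by apply: zle_sub => v Tv; exists v, 0; split=> //;
       [exists 0|]; rewrite ?scale0r ?addr0.
  apply: chain_lt (leline x Xx) h2 irTX; apply: chain_lt cT leT h1 _.
  by apply: irr_padd irT _; apply: irr_pline.
have [leXT|] := classic (zle (padd T X) T).
  exact: zle_padd.
(* Where [f] is nonzero at [t + y], the first alternative of [dicho] fails for [y]. A supposed [h]
   with nonzero value at [v + x] keeps one at [v + y] for general [y] in [X], so a single [y] serves
   both purposes. *)
move=> /not_zle [f [_ [fT [[t [x0 [Tt Xx0 ->]]] fx0]]]].
move=> h hTX _ [v [x [TXv Xx ->]]].
apply/eqP; apply: contraT => hvx.
have [||y [Xy]] := @irr_meet X (transl t f) (transl v h) x0 x irX Xx0 _ Xx.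
- by rewrite ev_transl addrC.
- by rewrite ev_transl addrC.
rewrite !ev_transl ![y + _]addrC => fy /eqP[].
have [le|le] := dicho y Xy.
  case/eqP: fy; apply: (le f fT); exists t, y; split=> //.
  by exists 1; rewrite scale1r.
have hline := leline y Xy h hTX.
(* [T + F y] is stable under translation by [y], and its closure contains [T + X]. *)
have htr : vanishes (padd T (pline y)) (transl y h).
  move=> _ [w [_ [Tw [c ->] ->]]]; rewrite ev_transl; apply: hline.
  by exists w, ((c + 1) *: y); split=> //;
     [exists (c + 1)|rewrite scalerDl scale1r addrA].
by have := le _ htr v TXv; rewrite ev_transl.
Qed.

(* If [x] is already proportional to one of the points, only its coefficient
   changes. *)
Lemma in_span_of_add X v r x : (forall w, X w -> w != 0) -> X x -> in_span_of X v r ->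
  exists2 r', (r' <= r.+1)%N & in_span_of X (v + x) r'.
Proof.
move=> X0 Xx [xs [Xxs [dist [c ->]]]].
have [[i [a ->]]|new] := classic (exists i a, x = a *: xs i).
  exists r => //; exists xs; do 2!split=> //.
  exists (fun j => c j + (if j == i then a else 0)).
  under [RHS]eq_bigr do rewrite scalerDl.
  rewrite big_split /=; congr (_ + _).
  rewrite (bigD1 i) //= eqxx big1 ?addr0 // => j /negPf ->.
  by rewrite scale0r.
exists r.+1 => //.
exists (fun i => if unlift ord0 i is Some j then xs j else x); split.
  by move=> i; case: unliftP.
split.
  move=> i j; case: (unliftP ord0 i) => [i'|] ->; case: (unliftP ord0 j) => [j'|] -> //.
  - by rewrite (inj_eq lift_inj); apply: dist.
  - by move=> _ [a e]; apply: new; exists i', a.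
  - move=> _ [a e]; apply: new; exists j', a^-1.
    rewrite e scalerA mulVf ?scale1r //; apply: contraTneq (X0 _ (Xxs j')) => a0.
    by rewrite e a0 scale0r eqxx.
exists (fun i => if unlift ord0 i is Some j then c j else 1).
rewrite big_ord_recl unlift_none scale1r addrC; congr (_ + _).
by apply: eq_bigr => i _; rewrite liftK.
Qed.

(** * Rank *)

Lemma rank_exists X v r : v != 0 -> in_span_of X v r ->
  exists2 j, (j <= r)%N & has_rank X v j.
Proof.
elim/ltn_ind: r => r IH v0 vr.
have [[r' ltr vr']|no] := classic (exists2 r', (r' < r)%N & in_span_of X v r').
  have [j lej rj] := IH r' ltr v0 vr'; exists j => //.
  exact: leq_trans lej (ltnW ltr).
exists r => //; do 2!split=> //; move=> r' ltr vr'; apply: no.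
by exists r'.
Qed.

Lemma rank_unique X v i j : has_rank X v i -> has_rank X v j -> i = j.
Proof.
move=> [_ [vi mi]] [_ [vj mj]]; apply/eqP; rewrite eqn_leq.
by apply/andP; split; rewrite leqNgt; apply/negP; [move/mi|move/mj].
Qed.

Lemma in_span_of_scale X v r (c : F) : in_span_of X v r -> in_span_of X (c *: v) r.
Proof.
move=> [xs [Xxs [dist [a ->]]]]; exists xs; do 2!split=> //.
by exists (fun i => c * a i); rewrite scaler_sumr; apply: eq_bigr => i _; rewrite scalerA.
Qed.

Lemma has_rank_scalable X j : scalable_set (fun v => has_rank X v j).
Proof.
move=> c v c0 [v0 [vj mj]]; split; first by rewrite scaler_eq0 negb_or c0.
split; first exact: in_span_of_scale.
move=> r ltr /(in_span_of_scale c^-1); rewrite scalerA mulVf // scale1r.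
exact: mj.
Qed.

Section Rank.

Variables (X : pset F N) (g : nat).
Hypotheses (irX : irr X) (scX : scalable_set X) (X0 : forall v, X v -> v != 0).
Hypotheses (ndX : nondegenerate_var X).
Hypothesis rank_ne_g : forall j, j != g -> ~ zle (fun=> True) (fun v => has_rank X v j).
Hypothesis g_gt0 : (0 < g)%N.

Let R j : pset F N := fun v => has_rank X v j.

Lemma rank_add v x j : (g < j)%N -> X x -> R j v ->
  R j.-1 (v + x) \/ R j (v + x) \/ R j.+1 (v + x).
Proof.
move=> gj Xx [v0 [vj mj]].
have XNx : X (- x) by rewrite -scaleN1r; apply: scX; rewrite ?oppr_eq0 ?oner_eq0.
have back r : in_span_of X (v + x) r -> (j <= r.+1)%N.
  move=> /(in_span_of_add X0 XNx) [r' ler']; rewrite addrK => vr'.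
  by apply: leq_trans ler'; rewrite leqNgt; apply/negP => /mj.
have [r ler vxr] := in_span_of_add X0 Xx vj.
(* Otherwise [v] would have rank at most 1, hence at most [g]. *)
have vx0 : v + x != 0.
  apply: contraTneq gj => vx0; rewrite -leqNgt.
  apply: leq_trans g_gt0; apply: (back 0%N); rewrite vx0.
  exists (fun _ => 0); split; first by case.
  by split; [case|exists (fun _ => 0); rewrite big_ord0].
have [i lei ri] := rank_exists vx0 vxr.
have := back i (proj1 (proj2 ri)); have := leq_trans lei ler.
move: ri; case: (ltngtP i j) => [lt_ij|gt_ij|->] ri le1 le2; last by right; left.
  by left; rewrite (_ : j.-1 = i) //; lia.
by right; right; rewrite (_ : j.+1 = i) //; lia.
Qed.

(* Induction on the codimension of [T]: the join of [T] with [X] meets densely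
   the locus of rank [j - 1], [j] or [j + 1].  In the last two cases [T] is
   strictly contained in a larger irreducible set of points of rank [j], after
   joining with [X] once more in the last case. *)
Lemma descend_rank n T j : chain n T -> (g < j)%N -> psubset T (R j) ->
  exists T', [/\ irr T', psubset T' (R j), zle T T' & zle (padd T' X) (R j.-1)].
Proof.
have [m] := ubnP (N.+1 - n); elim: m => // m IH in n T j *.
rewrite ltnS => lem cT gj sTR; have irT := chain_irr cT.
pose J := padd T X; have irJ : irr J by apply: irr_padd.
have leTJ : zle T J by apply: zle_cone_padd.
have nJT : ~ zle J T.
  move=> leJT; apply: (@rank_ne_g j); first by rewrite gtn_eqF.
  apply: zle_trans (zle_sub sTR).
  exact: translation_stable_dense scX ndX (proj1 irT) leJT.
have bigger U : irr U -> psubset U (R j) -> zle J U ->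
    exists T', [/\ irr T', psubset T' (R j), zle T T' & zle (padd T' X) (R j.-1)].
  move=> irU sUR leJU; have leTU := zle_trans leTJ leJU.
  have cU : chain n.+1 U.
    by apply: chain_lt cT leTU _ irU => leUT; apply: nJT; apply: zle_trans leJU leUT.
  have [|T' [irT' sT' leUT' leT']] := IH n.+1 U j _ cU gj sUR.
    by have := chain_bound cU; lia.
  by exists T'; split=> //; apply: zle_trans leUT'.
pose D i : pset F N := fun v => J v /\ R i v.
have irD i : zle J (D i) -> irr (D i).
  by move=> le; apply: irr_eqv irJ => //; apply: zle_sub => v [].
have : zle J (fun v => D j.-1 v \/ (D j v \/ D j.+1 v)).
  apply: zle_sub => v Jv; have [t [x [Tt Xx e]]] := Jv.
  have := rank_add gj Xx (sTR t Tt); rewrite -e.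
  by case=> [?|[?|?]]; [left|right; left|right; right].
case/(irr_cover irJ) => [le|/(irr_cover irJ)[le|le]].
- by exists T; split=> //; apply: zle_trans le _; apply: zle_sub => v [].
- by apply: bigger (irD _ le) _ le => v [].
have irU := irD _ le; pose U := D j.+1.
have leTU : zle T U := zle_trans leTJ le.
have cU : chain n.+1 U.
  by apply: chain_lt cT leTU _ irU => leUT; apply: nJT; apply: zle_trans le leUT.
(* [U] is larger than [T], so the induction applies to it at rank [j.+1]; the resulting join [V + X]
   lies in the closure of rank [j] and contains [J] in its own closure. *)
have [|||V [irV sV leUV leV]] := IH n.+1 U j.+1 _ cU.
- by have := chain_bound cU; lia.
- exact: ltnW.
- by move=> v [].
have [W [sW irW leVW]] := irr_sub_dense (irr_padd irV irX) leV.
apply: bigger irW sW _; apply: zle_trans leVW; apply: zle_trans le _.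
by apply: zle_trans leUV _; apply: zle_cone_padd.
Qed.

Lemma chain_to_next_rank n k S : (0 < k)%N -> chain n S ->
  zle S (R (g + k)) -> exists2 S', chain (n + 2 * k.-1) S' & zle S' (R g.+1).
Proof.
elim: k n S => // -[_ n S _|k IH n S _].
  by rewrite addn1 addn0 => cS leS; exists S.
move=> cS leS; have [T [sT irT leST]] := irr_sub_dense (chain_irr cS) leS.
have [|T' [irT' sT' leTT' leT']] := descend_rank (chain_le cS leST irT) _ sT.
  by rewrite -addn1 leq_add2l.
have [|||S' cS' leS'] := IH n.+2 (padd T' X).
- by [].
- apply: chain_padd_line => //; last exact: chain_le cS (zle_trans leST leTT') irT'.
  (* The rank reached is still above [g], so the join is not dense and both dimensions are
     gained. *)
  move=> dense; apply: (@rank_ne_g (g + k.+2).-1); first by lia.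
  exact: zle_trans dense leT'.
- by rewrite addnS in leT'.
by exists S' => //; rewrite (_ : n + _ = n.+2 + 2 * k.+1.-1)%N //; lia.
Qed.

(** The [k.-1] steps down to rank [g.+1] gain two dimensions each; the strict inclusion in the whole
    space gains one more. *)
Lemma rank_locus_codim n k S : (0 < k)%N -> chain n S -> zle S (R (g + k)) ->
  (n + 2 * k - 1 <= N.+1)%N.
Proof.
move=> k0 cS /(chain_to_next_rank k0 cS) [S' cS' leS'].
have : chain (n + 2 * k.-1).+1 (fun _ : pt F N => True).
  apply: chain_lt cS' _ _ irr_full; first exact: zle_sub.
  move=> dense; apply: (@rank_ne_g g.+1); first by rewrite gtn_eqF.
  exact: zle_trans dense leS'.
by move/chain_bound; lia.
Qed.

End Rank.

(** * From the projective statement to affine chains *)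

Lemma generic_rank_facts X g : generic_rank X g ->
  (0 < g)%N /\
  forall j, j != g -> ~ zle (fun=> True) (fun v => has_rank X v j).
Proof.
move=> [U [[U0 [E [homE hE]]] [dU rU]]].
have [u Uu] : exists u, U u.
  apply: NNPP => nU; have c0 : const_mx 1 != 0 :> pt F N.
    by apply/eqP => /rowP /(_ ord0) /eqP; rewrite !mxE oner_eq0.
  (* The empty set is closed, as the zero locus of 1, so a dense set is nonempty. *)
  have [_ /(_ (fun=> False))] := dU _ c0; apply.
    exists (eq 1); split=> [_ <-|v]; first by exists 0%N; apply: dhomog1.
    by split=> // -[_ /(_ 1 erefl)/eqP]; rewrite [ev _ _]meval1 oner_eq0.
  by move=> w Uw; case: nU; exists w.
split.
  rewrite lt0n; apply/negP => /eqP g0; have [u0 [[xs [_ [_ [c e]]]] _]] := rU u Uu.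
  by move: c xs e u0; rewrite g0 => c xs ->; rewrite big_ord0 eqxx.
(* This [p] vanishes off [U], hence at every point of rank other than [g]. *)
have [p Ep pu] : exists2 p, E p & ev p u != 0.
  apply: NNPP => no; have [|_ []//] := proj2 (hE u).
  split; first exact: U0.
  by move=> p Ep; apply/eqP; apply: contraT => pu; case: no; exists p.
move=> j jg dense; case/eqP: pu; apply: (dense p) => // v rv.
have v0 : v != 0 by case: rv.
apply: NNPP => pv; have Uv : U v.
  apply: NNPP => nUv; have [_ /(_ p Ep)] := proj1 (hE v) (conj v0 nUv).
  exact: pv.
by move/eqP: jg; apply; apply: rank_unique rv (rU v Uv).
Qed.

(* Prepending the origin to a chain of projective sets gives a chain of affine
   cones that is one step longer. *)
Lemma chain_in_chain (W : pset F N) d : chain_in W d ->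
  exists2 S, chain d.+1 S & psubset S W.
Proof.
move=> [Z [irZ [ltZ ZW]]]; exists (Z d) => //.
have irrZ i : (i <= d)%N -> irr (Z i) by move/irZ/zirreducible_irr.
suff H i : (i <= d)%N -> chain i.+1 (Z i) by apply: H.
elim: i => [_|i IH ltid]; last first.
  have [sub [v [Zv nZv]]] := ltZ i ltid.
  apply: chain_lt (IH (ltnW ltid)) (zle_sub sub) _ (irrZ _ ltid).
  exact: zclosed_not_zle (proj1 (irZ i (ltnW ltid))) (proj1 (irZ _ ltid)) Zv nZv.
have cZ := proj1 (irZ 0%N (leq0n d)); have ir0 := irrZ 0%N (leq0n d).
have [[v Zv] _] := ir0.
apply: (@chain_lt 0 (pline 0)) => //.
- by split=> //; apply: irr_pline.
- move=> p pZ _ [c ->]; rewrite scaler0.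
  have : ray p v = 0.
    by apply: ray_eq0 => t t0; apply: pZ; apply: zclosed_scalable.
  move/(congr1 (fun P : {poly F} => P.[0])); rewrite ray_horner horner0.
  by rewrite scale0r.
- move=> le; have /eqP := zclosed_neq0 cZ Zv; apply.
  apply/rowP => i; rewrite [RHS]mxE.
  have := le 'X_i _ v Zv; rewrite [ev _ _]mevalXU; apply.
  by move=> _ [c ->]; rewrite [ev _ _]mevalXU scaler0 mxE.
Qed.

End Zariski.


Theorem theorem3p6 (F : closedFieldType) (N : nat) (X : pset F N) :
  [pchar F] =i pred0 ->
  zirreducible X -> nondegenerate_var X ->
  forall g : nat, generic_rank X g ->
  forall k : nat, (1 <= k)%N -> codim_ge (Wrank X (g + k)) (2 * k - 1).
Proof.
move=> _ irX ndX g /generic_rank_facts [g0 ne_g] k k0 _ d /chain_in_chain [S cS sSW].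
have X0 v : X v -> v != 0 by apply: zclosed_neq0 (proj1 irX).
have leS : zle S (fun v => has_rank X v (g + k)).
  apply: zle_trans (zle_sub sSW) _; apply: zclosure_zle; first exact: has_rank_scalable.
  by move=> v [].
have := rank_locus_codim (zirreducible_irr irX) (zclosed_scalable (proj1 irX)) X0
  ndX ne_g g0 k0 cS leS.
(* The chain has length [d.+1] in affine dimension [N.+1], so the two shifts cancel. *)
by lia.
Qed.
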